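(* If $g\in GL(2,\mathcal{O}_{-3})$ is of finite order $r$ and $\det(g)=e^{-\frac{\pi i}{3}}$, then $$r=6\quad\text{and}\quad\mathrm{tr}(g)\in\left\{0,\pm\left(\tfrac32-\tfrac{\sqrt{-3}}{2}\right)\right\}.$$ More precisely, for the eigenvalues $\lambda_1,\lambda_2$ of $g$ (up to a transposition): (i) $\mathrm{tr}(g)=0$ exactly when $\lambda_1=e^{\frac{\pi i}{3}}$, $\lambda_2=e^{-\frac{2\pi i}{3}}$; (ii) $\mathrm{tr}(g)=\frac32-\frac{\sqrt3}{2}i$ exactly when $\lambda_1=e^{-\frac{\pi i}{3}}$, $\lambda_2=1$; (iii) $\mathrm{tr}(g)=-\frac32+\frac{\sqrt3}{2}i$ exactly when $\lambda_1=e^{\frac{2\pi i}{3}}$, $\lambda_2=-1$.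
   Context: $\mathcal{O}_{-3}=\mathbb{Z}+\frac{1+\sqrt{-3}}{2}\mathbb{Z}$ is the ring of the Eisenstein integers, $\sqrt{-3}=i\sqrt3$, and $GL(2,\mathcal{O}_{-3})$ is the group of $2\times2$ matrices over $\mathcal{O}_{-3}$ with determinant in $\mathcal{O}_{-3}^*=\langle e^{\frac{\pi i}{3}}\rangle$. *)

(* Defs.v *)
(* MathComp world: complex numbers are R[i] for an arbitrary R : realType. *)
From mathcomp Require Import all_boot all_order all_algebra.
From mathcomp Require Import boolp reals trigo.
From mathcomp Require Export complex.

Set Implicit Arguments.
Unset Strict Implicit.
Unset Printing Implicit Defensive.

Import GRing.Theory Num.Theory.
Local Open Scope ring_scope.
Local Open Scope complex_scope.

(* e^(i t), by Euler's formula; the library has no complex exponential. *)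
Definition expi {R : realType} (t : R) : R[i] := cos t +i* sin t.

(* i * sqrt 3, the square root of -3 in the upper half-plane. *)
Definition sqrtN3 {R : realType} : R[i] := 0 +i* Num.sqrt 3.

Definition eisenstein {R : realType} : {pred R[i]} :=
  [pred z : R[i] | `[< exists a b : int,
     z = a%:~R + (1 + sqrtN3) / 2 * b%:~R >]].

(* The units of the ring of Eisenstein integers; inverses in the field R[i]
   would not do, as they need not be Eisenstein integers. *)
Definition eisenstein_unit {R : realType} (u : R[i]) : Prop :=
  u \in eisenstein /\ exists2 v, v \in eisenstein & u * v = 1.

Definition GL2_eisenstein {R : realType} (g : 'M[R[i]]_2) : Prop :=
  g \is a mxOver eisenstein /\ eisenstein_unit (\det g).

Definition has_order {A : nzRingType} (g : A) (r : nat) : Prop :=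
  [/\ (0 < r)%N, g ^+ r = 1
    & forall m : nat, (0 < m)%N -> g ^+ m = 1 -> (r <= m)%N].

(* l1, l2 are the two eigenvalues of g, listed with algebraic multiplicity. *)
Definition eigenvalues2 {F : fieldType} (g : 'M[F]_2) (l1 l2 : F) : Prop :=
  char_poly g = ('X - l1%:P) * ('X - l2%:P).

(* Main.v *)
Require Import Defs.
From mathcomp Require Import all_boot all_order all_algebra.
From mathcomp Require Import boolp reals trigo.
From mathcomp Require Import ring lra zify.

Set Implicit Arguments.
Unset Strict Implicit.
Unset Printing Implicit Defensive.

Import Order.TTheory GRing.Theory Num.Theory.
Local Open Scope ring_scope.
Local Open Scope complex_scope.

(** Write w = e^(i pi/3), so that w^2 = w - 1, and d = e^(-i pi/3) = 1 - w for
    the determinant.  Since g has finite order, its eigenvalues l1, l2 are roots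
    of unity, so they have modulus 1 and conjugation inverts them.  Therefore
    the trace t = l1 + l2 satisfies t = l1 l2 (conj l1 + conj l2) = d conj t
    and |t| <= 2.

    The trace is also an Eisenstein integer a + b w.  In coordinates,
    t = d conj t says a = - 2 b, that is t = b (w - 2)
    ([eisenstein_twisted_conj_fixed]), and |w - 2|^2 = 3 turns |t| <= 2 into
    3 b^2 <= 4.  Hence b is 0, 1 or -1, and these are the three possible traces
    ([eisenstein_trace_values]).

    A pair is determined up to order by its sum and product
    ([perm_eq_pairP]), so each trace corresponds to exactly one pair of
    eigenvalues; it is enough to check that the pair claimed has product d and
    the right sum.

    For the order, each of these pairs consists of two distinct sixth roots of
    unity, which forces g^6 = 1 ([eigenvalues2_exp_eq1]).  Conversely, g^r = 1
    gives d^r = 1, and d is a primitive sixth root of unity ([prim6_root]), so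
    6 divides r. *)

(** * Eigenvalues of 2 x 2 matrices *)

Lemma eigenvalues2_trace (F : fieldType) (g : 'M[F]_2) (l1 l2 : F) :
  eigenvalues2 g l1 l2 -> \tr g = l1 + l2.
Proof.
move=> gE; have := char_poly_trace g isT; rewrite gE /= => e.
apply: oppr_inj; rewrite -e mulrBr !mulrBl -!polyCM.
by rewrite !(coefB, coefMX, coefXM, coefX, coefCM, coefMC, coefC) /=; ring.
Qed.

Lemma eigenvalues2_det (F : fieldType) (g : 'M[F]_2) (l1 l2 : F) :
  eigenvalues2 g l1 l2 -> \det g = l1 * l2.
Proof.
move=> gE; have := char_poly_det g; rewrite gE sqrrN expr1n mul1r => <-.
by rewrite coef0M !coefB !coefX !coefC /= !sub0r mulrNN.
Qed.

Lemma eigenvalues2_exists (F : closedFieldType) (g : 'M[F]_2) :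
  exists l1 l2, eigenvalues2 g l1 l2.
Proof.
have [s] := closed_field_poly_normal (char_poly g).
rewrite (monicP (char_poly_monic g)) scale1r => gE.
have := size_char_poly g; rewrite gE size_prod_XsubC => -[].
case: s gE => [|l1 [|l2 []]] // gE _; exists l1, l2.
by rewrite /eigenvalues2 gE !big_cons big_nil mulr1.
Qed.

Lemma eigenvalues2_root (F : fieldType) (g : 'M[F]_2) (l1 l2 : F) :
  eigenvalues2 g l1 l2 -> eigenvalue g l1 /\ eigenvalue g l2.
Proof.
by move=> gE; rewrite !eigenvalue_root_char gE !rootM !root_XsubC !eqxx orbT.
Qed.

Lemma det_exp (F : comNzRingType) (n k : nat) (A : 'M[F]_n.+1) :
  \det (A ^+ k) = \det A ^+ k.
Proof. by elim: k => [|k IHk]; rewrite ?det1 // !exprS det_mulmx IHk. Qed.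

Lemma eigenvalue_exp_eq1 (F : fieldType) (n r : nat) (A : 'M[F]_n.+1) (l : F) :
  A ^+ r = 1 -> eigenvalue A l -> l ^+ r = 1.
Proof.
move=> Ar /eigenvalueP[v vA v0].
have vAk k : v *m A ^+ k = l ^+ k *: v.
  elim: k => [|k IHk]; first by rewrite !expr0 mulmx1 scale1r.
  by rewrite !exprSr mulmxA IHk -scalemxAl vA scalerA.
have /eqP := vAk r; rewrite Ar mulmx1 -subr_eq0 -{1}[v]scale1r -scalerBl.
by rewrite scaler_eq0 (negPf v0) orbF subr_eq0 => /eqP.
Qed.

(** Both pairs are the roots of the same monic quadratic polynomial. *)
Lemma perm_eq_pairP (F : fieldType) (a b x y : F) :
  x * y = a * b -> x + y = a + b <-> perm_eq [:: x; y] [:: a; b].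
Proof.
move=> xyM; split=> [xyD | xyE].
  have yE : y = a + b - x by rewrite -xyD; ring.
  have : (x - a) * (x - b) == 0.
    rewrite (_ : _ * _ = x * x - (a + b) * x + a * b); last by ring.
    by rewrite -xyD -xyM; apply/eqP; ring.
  rewrite mulf_eq0 !subr_eq0 => /orP[] /eqP xE; rewrite yE xE.
    by rewrite addrAC subrr add0r.
  by rewrite addrK (perm_catC [:: b] [:: a]).
have : \sum_(z <- [:: x; y]) z = \sum_(z <- [:: a; b]) z by apply: perm_big.
by rewrite !big_cons !big_nil !addr0.
Qed.

(** Distinctness makes the coprime linear factors of the characteristic
    polynomial both divide X^n - 1, so Cayley-Hamilton applies.  The condition l1 != l2
    excludes nontrivial Jordan blocks, such as unipotent matrices of infinite
    order. *)
Lemma eigenvalues2_exp_eq1 (F : fieldType) (n : nat) (g : 'M[F]_2) (l1 l2 : F) :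
  eigenvalues2 g l1 l2 -> l1 != l2 -> l1 ^+ n = 1 -> l2 ^+ n = 1 -> g ^+ n = 1.
Proof.
move=> gE l12 l1n l2n.
have : char_poly g %| 'X^n - 1.
  rewrite gE Gauss_dvdp ?coprimep_XsubC ?root_XsubC 1?eq_sym //.
  by rewrite !dvdp_XsubCl !rootE !hornerE l1n l2n subrr eqxx.
case/dvdpP => q /(congr1 (horner_mx g)).
rewrite rmorphM /= Cayley_Hamilton mulr0 rmorphB rmorphXn /= horner_mx_X.
by rewrite rmorph1 => /eqP; rewrite subr_eq0 => /eqP.
Qed.

(** * The sixth root of unity e^(i pi/3) *)

(** The hypothesis says that x is a root of the sixth cyclotomic polynomial.
    It gives x^3 = -1, so the order of x divides 6; being a proper divisor would
    make it divide 2 or 3, and both x^2 = 1 and x^3 = 1 fail in characteristic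
    zero. *)
Lemma prim6_root (F : numFieldType) (x : F) :
  x ^+ 2 = x - 1 -> 6.-primitive_root x.
Proof.
move=> x2; have x3 : x ^+ 3 = -1 by rewrite exprS x2 mulrBr -expr2 x2; ring.
have x6 : x ^+ 6 = 1 by rewrite (exprM x 3 2) x3 sqrrN expr1n.
have x3N1 : x ^+ 3 != 1 by rewrite x3 eqNr oner_eq0.
have x2N1 : x ^+ 2 != 1.
  (* If x^2 = 1 then x = 1 + 1, hence 4 = 1, that is 3 = 0. *)
  apply: contraNneq x3N1 => x21; move: x2; rewrite x21 => /eqP.
  rewrite eq_sym subr_eq => /eqP xE.
  have /eqP : 3%:R = 0 :> F.
    by apply: (addIr 1); rewrite add0r -[RHS]x21 xE; ring.
  by rewrite pnatr_eq0.
have [//|m prim_m] := prim_order_exists _ x6.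
case: (eqVneq m 6%N) => [<- // | mN6 m_dvd6].
have : (m %| 2)%N || (m %| 3)%N.
  move: mN6 m_dvd6; have := dvdn_leq (isT : 0 < 6)%N.
  by case: m {prim_m} => [|[|[|[|[|[|[]]]]]]].
by rewrite !(prim_order_dvd prim_m) (negPf x2N1) (negPf x3N1).
Qed.

Lemma expi0 (R : realType) : expi 0 = 1 :> R[i].
Proof. by rewrite /expi cos0 sin0. Qed.

Lemma expiD (R : realType) (s t : R) : expi (s + t) = expi s * expi t.
Proof.
rewrite /expi cosD sinD; apply/eqP; rewrite eq_complex /= eqxx /=.
by apply/eqP; ring.
Qed.

Lemma expiN (R : realType) (t : R) : expi (- t) = conjc (expi t).
Proof. by rewrite /expi cosN sinN. Qed.

(** With c = cos (pi/3), the triple-angle formula and cos pi = -1 give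
    4 c^3 - 3 c + 1 = (c + 1) (2 c - 1)^2 = 0; as c > 0, this leaves c = 1/2. *)
Lemma expi_pi3 (R : realType) : expi (pi / 3) = (1 + sqrtN3) / 2 :> R[i].
Proof.
set c := cos (pi / 3 : R); set s := sin (pi / 3 : R).
have pi0 := pi_gt0 R.
have c0 : 0 < c by apply: cos_gt0_pihalf; apply/andP; split; lra.
have s0 : 0 < s by apply: sin_gt0_pi; apply/andP; split; lra.
have cs : c ^+ 2 + s ^+ 2 = 1 by apply: cos2Dsin2.
have : cos (pi / 3 *+ 2 + pi / 3) = -1 :> R.
  by rewrite -cospi; congr cos; field.
rewrite cosD mulr2n cosD sinD -/c -/s => e3.
have /eqP : (c + 1) * (2 * c - 1) ^+ 2 = 0.
  transitivity ((c * c - s * s) * c - (s * c + c * s) * s - -1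
      + 3 * c * (c ^+ 2 + s ^+ 2 - 1)); first by ring.
  by rewrite e3 cs !subrr mulr0 addr0.
rewrite mulf_eq0 gt_eqF ?addr_gt0 //= sqrf_eq0 => /eqP ce.
have cE : c = 1 / 2 by lra.
have sE : s = Num.sqrt 3 / 2.
  have -> : 3 = (2 * s) ^+ 2 :> R.
    by rewrite exprMn -(addrK (c ^+ 2) (s ^+ 2)) [s ^+ 2 + _]addrC cs cE; field.
  by rewrite sqrtr_sqr gtr0_norm ?mulr_gt0 //; field.
rewrite -[2 in RHS](rmorph_nat (real_complex R)) /sqrtN3 -fmorphV /=.
apply/eqP; rewrite /expi -/c -/s cE sE eq_complex /= !mulr0 !add0r subr0 addr0.
by rewrite !eqxx.
Qed.

Lemma expi_pi3_sqr (R : realType) :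
  expi (pi / 3) ^+ 2 = expi (pi / 3) - 1 :> R[i].
Proof.
have : sqrtN3 ^+ 2 = - 3 :> R[i].
  rewrite -[3 in RHS](rmorph_nat (real_complex R)).
  apply/eqP; rewrite expr2 eq_complex /= !mul0r !mulr0 sub0r addr0.
  by rewrite -expr2 sqr_sqrtr ?ler0n // oppr0 !eqxx.
rewrite expi_pi3 => s2.
transitivity ((1 + 2 * sqrtN3 + sqrtN3 ^+ 2) / 4 : R[i]); first by field.
by rewrite s2; field.
Qed.

Lemma expi_Npi3 (R : realType) : expi (- (pi / 3)) = 1 - expi (pi / 3) :> R[i].
Proof.
set w := expi (pi / 3).
have wV : w * (1 - w) = 1.
  by rewrite mulrBr mulr1 -expr2 expi_pi3_sqr opprB addrC subrK.
have w0 : w != 0.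
  by apply: contraTneq (oner_neq0 R[i]) => w0; rewrite -wV w0 mul0r eqxx.
by apply: (mulfI w0); rewrite wV -expiD subrr expi0.
Qed.

Lemma conjc_expi_pi3 (R : realType) :
  conjc (expi (pi / 3)) = 1 - expi (pi / 3) :> R[i].
Proof. by rewrite -expiN expi_Npi3. Qed.

(** * Traces of finite-order matrices over the Eisenstein integers *)

Lemma root_of_unity_conjc (R : rcfType) (r : nat) (l : R[i]) :
  (0 < r)%N -> l ^+ r = 1 -> `|l| = 1 /\ l * conjc l = 1.
Proof.
move=> r0 lr; have l1 : `|l| = 1.
  by apply/eqP; rewrite -(pexpr_eq1 r0) // -normrX lr normr1.
by rewrite -sqr_normc l1 expr1n.
Qed.

Lemma mxtrace_eisenstein (R : realType) (n : nat) (g : 'M[R[i]]_n) :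
  g \is a mxOver eisenstein ->
  exists a b : int, \tr g = a%:~R + b%:~R * expi (pi / 3).
Proof.
move=> /mxOverP gO; rewrite expi_pi3.
apply: (big_rec (fun z => exists a b : int, z = a%:~R + b%:~R * _)).
  by exists 0, 0; rewrite mul0r addr0.
move=> i _ _ [a [b ->]]; have /asboolP[a' [b' ->]] := gO i i.
by exists (a' + a), (b' + b); rewrite !rmorphD /=; ring.
Qed.

(** The map z |-> e^(-i pi/3) conj z is a reflection of the Eisenstein lattice,
    and its fixed line meets the lattice in the multiples of w - 2.  Indeed, for
    t = a + b w the difference of the two sides is w (a + 2 b). *)
Lemma eisenstein_twisted_conj_fixed (R : realType) (a b : int) (t : R[i]) :
  t = a%:~R + b%:~R * expi (pi / 3) -> t = expi (- (pi / 3)) * conjc t ->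
  t = b%:~R * (expi (pi / 3) - 2).
Proof.
rewrite expi_Npi3; move: (expi_pi3_sqr R) (conjc_expi_pi3 R).
move: (expi _) => w w2 wJ tE.
rewrite {2}tE rmorphD rmorphM !rmorph_int /= wJ => tJ.
have w0 : w != 0.
  by apply: contra_eq_neq w2 => ->; rewrite expr0n sub0r eq_sym oppr_eq0 oner_neq0.
have : w * (a%:~R + 2 * b%:~R) = 0.
  transitivity (t - (1 - w) * (a%:~R + b%:~R * (1 - w))
                + b%:~R * (w ^+ 2 - (w - 1))).
    by rewrite tE; ring.
  by rewrite -tJ w2 !subrr mulr0 addr0.
move/eqP; rewrite mulf_eq0 (negPf w0) /= addr_eq0 => /eqP aE.
by rewrite tE aE; ring.
Qed.

(** By the previous lemma t = b (w - 2), and |w - 2|^2 = 3, so the bound reads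
    3 b^2 <= 4. *)
Lemma eisenstein_trace_values (R : realType) (a b : int) (t : R[i]) :
  t = a%:~R + b%:~R * expi (pi / 3) -> t = expi (- (pi / 3)) * conjc t ->
  `|t| <= 2 -> t \in [:: 0; 2 - expi (pi / 3); expi (pi / 3) - 2].
Proof.
move=> tE tJ t2; have tb := eisenstein_twisted_conj_fixed tE tJ.
have: (b ^+ 2 * 3)%:~R <= 4 :> R[i].
  have -> : (b ^+ 2 * 3)%:~R = `|t| ^+ 2.
    rewrite sqr_normc tb; move: (expi_pi3_sqr R) (conjc_expi_pi3 R).
    move: (expi _) => w w2 wJ.
    rewrite [conjc _]rmorphM rmorphB rmorph_nat rmorph_int /= wJ.
    transitivity (b%:~R ^+ 2 * (3 + (w - 1 - w ^+ 2)) : R[i]); last by ring.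
    by rewrite w2 subrr addr0 rmorphM rmorphXn.
  rewrite -[4%:R](_ : 2 ^+ 2 = _); last by ring.
  by rewrite lerXn2r ?nnegrE ?normr_ge0.
rewrite -[4%:R]/(4%:Z%:~R) ler_int => b3.
have : b \in [:: 0; 1; -1].
  by rewrite !inE; nia.
rewrite tb !inE => /or3P[] /eqP ->.
all: by rewrite ?mul0r ?mul1r ?mulN1r ?opprB ?eqxx ?orbT.
Qed.

Theorem proposition20 (R : realType) (g : 'M[R[i]]_2) (r : nat)
    (g_GL : GL2_eisenstein g)
    (g_order : has_order g r)
    (g_det : \det g = expi (- (pi / 3))) :
  [/\ r = 6%N,
      \tr g \in [:: 0; 3 / 2 - sqrtN3 / 2; - (3 / 2 - sqrtN3 / 2)]
    & forall l1 l2 : R[i], eigenvalues2 g l1 l2 ->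
      [/\ \tr g = 0 <->
            perm_eq [:: l1; l2] [:: expi (pi / 3); expi (- (2 * pi / 3))],
          \tr g = 3 / 2 - sqrtN3 / 2 <->
            perm_eq [:: l1; l2] [:: expi (- (pi / 3)); 1]
        & \tr g = - (3 / 2) + sqrtN3 / 2 <->
            perm_eq [:: l1; l2] [:: expi (2 * pi / 3); - 1]]].
Proof.
have wdE := expi_Npi3 R; have w2 := expi_pi3_sqr R; have wE := expi_pi3 R.
set w := expi (pi / 3) in wdE w2 wE *.
set d := expi (- (pi / 3)) in g_det wdE *.
have -> : 3 / 2 - sqrtN3 / 2 = 2 - w :> R[i] by rewrite wE; field.
have -> : - (3 / 2) + sqrtN3 / 2 = w - 2 :> R[i] by rewrite wE; field.
have -> : expi (2 * pi / 3) = w - 1 :> R[i].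
  by rewrite -w2 expr2 -expiD; congr expi; field.
have -> : expi (- (2 * pi / 3)) = - w :> R[i].
  transitivity (d ^+ 2); first by rewrite expr2 -expiD; congr expi; field.
  by rewrite wdE sqrrB w2; ring.
rewrite opprB; have [r_gt0 gr r_min] := g_order.
have eigE (l1 l2 : R[i]) : eigenvalues2 g l1 l2 ->
    [/\ \tr g = 0 <-> perm_eq [:: l1; l2] [:: w; - w],
      \tr g = 2 - w <-> perm_eq [:: l1; l2] [:: d; 1]
    & \tr g = w - 2 <-> perm_eq [:: l1; l2] [:: w - 1; -1]].
  move=> gE; have gM := esym (eigenvalues2_det gE); rewrite g_det in gM.
  rewrite (eigenvalues2_trace gE); split.
  - rewrite -(subrr w); apply: perm_eq_pairP.
    by rewrite gM mulrN -expr2 w2 opprB.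
  - rewrite (_ : 2 - w = d + 1); last by rewrite wdE; ring.
    by apply: perm_eq_pairP; rewrite gM mulr1.
  - rewrite (_ : w - 2 = w - 1 + -1); last by ring.
    by apply: perm_eq_pairP; rewrite gM mulrN1 opprB.
have [l1 [l2 gE]] := eigenvalues2_exists g.
have [gl1 gl2] := eigenvalues2_root gE.
have [l1n l1J] := root_of_unity_conjc r_gt0 (eigenvalue_exp_eq1 gr gl1).
have [l2n l2J] := root_of_unity_conjc r_gt0 (eigenvalue_exp_eq1 gr gl2).
have tr_vals : \tr g \in [:: 0; 2 - w; w - 2].
  have [a [b trE]] := mxtrace_eisenstein g_GL.1.
  apply: (eisenstein_trace_values trE); rewrite (eigenvalues2_trace gE).
    (* d (conj l1 + conj l2) = l2 + l1, as d = l1 l2 and l conj l = 1. *)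
    rewrite -/d -g_det (eigenvalues2_det gE) rmorphD /= mulrDr.
    by rewrite mulrAC l1J mul1r -mulrA l2J mulr1 addrC.
  by rewrite (le_trans (ler_normD _ _)) // l1n l2n.
split=> //.
have prim_w : 6.-primitive_root w by apply: prim6_root.
have prim_d : 6.-primitive_root d.
  by apply: prim6_root; rewrite wdE sqrrB w2; ring.
apply/eqP; rewrite eqn_leq; apply/andP; split; last first.
  rewrite dvdn_leq // (prim_order_dvd prim_d) -g_det.
  by rewrite -det_exp gr det1.
apply: r_min => //.
have w6 := prim_expr_order prim_w; have d6 := prim_expr_order prim_d.
have g6 (a b : R[i]) : a != b -> a ^+ 6 = 1 -> b ^+ 6 = 1 ->
    perm_eq [:: l1; l2] [:: a; b] -> g ^+ 6 = 1.
  move=> ab a6 b6 lab; have lU := perm_uniq lab.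
  have l6 l : l \in [:: l1; l2] -> l ^+ 6 = 1.
    by rewrite (perm_mem lab) !inE => /orP[] /eqP ->.
  apply: (eigenvalues2_exp_eq1 gE); rewrite ?l6 ?inE ?eqxx ?orbT //.
  by move: lU; rewrite /= !inE !andbT ab.
have w_neq0 : w != 0 by rewrite (prim_root_eq0 prim_w).
have [tr0 tr1 tr2] := eigE _ _ gE.
move: tr_vals; rewrite !inE => /or3P[] /eqP.
- move/tr0; apply: g6; rewrite ?sqrrN //.
    by rewrite -subr_eq0 opprK -mulr2n mulrn_eq0.
  by rewrite (exprM (- w) 2 3) sqrrN -exprM.
- move/tr1; apply: g6; rewrite ?expr1n //.
  by rewrite -(expr1 d) -(prim_order_dvd prim_d).
- move/tr2; apply: g6.
  + by rewrite -subr_eq0 opprK subrK.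
  + by rewrite -w2 -exprM mulnC exprM w6 expr1n.
  + by rewrite (exprM _ 2 3) sqrrN !expr1n.
Qed.
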